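(* Let $b>0$, $\delta>0$, $\eta>0$ be real constants and let $v$ be real with $0\le v<v_c:=\dfrac{\sqrt5-1}{2}$. Let $y(x,t)\in\mathbb{R}$ be the solution of the initial-boundary value problem $$y_{tt}+2\delta y_t+2v\,y_{xt}=\Big[1-v^2+\tfrac32 b\,y_x^2\Big]y_{xx}+2\eta\,y_x y_{xx}y_{xt}+\eta\,y_x^2\,y_{xxt},\qquad x\in(0,1),\ t\ge 0,$$ with boundary conditions $y(0,t)=y(1,t)=0$ for all $t\ge0$ and initial conditions $y(x,0)=f(x)$, $y_t(x,0)=g(x)$ for all $x\in(0,1)$, where $f\in C^1[0,1]$ and at least one of $f,g$ is not identically zero over $[0,1]$. Then $y(x,t)\to0$ as $t\to\infty$ for all $x\in[0,1]$.
   Context: Subscripts denote partial derivatives, e.g. $y_x=\partial y/\partial x$, $y_{xt}=\partial^2y/\partial x\partial t$, $y_{xxt}=\partial^3 y/\partial x^2\partial t$. The problem models a nonlinear axially moving string between two fixed eyelets with viscous damping $\delta$, Kelvin-Voigt damping $\eta$, and axial speed proportional to $v$. A solution is understood to be regular enough on $[0,1]\times[0,\infty)$ that all displayed derivatives exist, the boundary and initial conditions hold in the classical sense, and integration by parts in $x$ and differentiation in $t$ under integrals over $x\in[0,1]$ of polynomial expressions in $y,y_t,y_x$ are legitimate. *)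

(* Defs.v *)
From Stdlib Require Import Reals List.
From Coquelicot Require Import Coquelicot.
Import ListNotations.
Open Scope R_scope.

Definition unit_interval (x : R) : Prop := 0 <= x <= 1.

Definition half_line (t : R) : Prop := 0 <= t.

(** Coquelicot's [is_derive f s l] with the filter [locally s] restricted to
    [D]: two-sided at interior points of [D], one-sided at end points. *)
Definition is_derive_on (D : R -> Prop) (f : R -> R) (s l : R) : Prop :=
  filterdiff f (within D (locally s)) (fun h => scal h l).

(** [u_x] is the partial derivative of [u] in [x] on [0,1] x [0,oo). *)
Definition is_partial_x (u u_x : R -> R -> R) : Prop :=
  forall x t, unit_interval x -> half_line t ->
    is_derive_on unit_interval (fun z => u z t) x (u_x x t).

(** [u_t] is the partial derivative of [u] in [t] on [0,1] x [0,oo). *)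
Definition is_partial_t (u u_t : R -> R -> R) : Prop :=
  forall x t, unit_interval x -> half_line t ->
    is_derive_on half_line (fun s => u x s) t (u_t x t).

Definition C1_unit_interval (f : R -> R) : Prop :=
  exists f' : R -> R,
    (forall x, unit_interval x -> is_derive_on unit_interval f x (f' x)) /\
    continuous_on unit_interval f'.

Inductive polynomial_in (gs : list (R -> R -> R)) : (R -> R -> R) -> Prop :=
| polynomial_const (c : R) : polynomial_in gs (fun _ _ => c)
| polynomial_gen (u : R -> R -> R) : In u gs -> polynomial_in gs u
| polynomial_add (p q : R -> R -> R) :
    polynomial_in gs p -> polynomial_in gs q ->
    polynomial_in gs (fun x t => p x t + q x t)
| polynomial_mul (p q : R -> R -> R) :
    polynomial_in gs p -> polynomial_in gs q ->
    polynomial_in gs (fun x t => p x t * q x t).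

(** Differentiation in [t] under the integral over [0,1] is legitimate for
    polynomial expressions in [gs].  The integrability clauses are needed
    because [RInt] is total. *)
Definition diff_under_integral (gs : list (R -> R -> R)) : Prop :=
  forall p p_t : R -> R -> R,
    polynomial_in gs p -> is_partial_t p p_t ->
    forall t, half_line t ->
      ex_RInt (fun x => p x t) 0 1 /\
      ex_RInt (fun x => p_t x t) 0 1 /\
      is_derive_on half_line (fun s => RInt (fun x => p x s) 0 1) t
        (RInt (fun x => p_t x t) 0 1).

(** Integration by parts in [x] over [0,1] is legitimate for products of
    polynomial expressions in [gs]. *)
Definition integration_by_parts (gs : list (R -> R -> R)) : Prop :=
  forall p p_x q q_x : R -> R -> R,
    polynomial_in gs p -> polynomial_in gs q ->
    is_partial_x p p_x -> is_partial_x q q_x ->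
    forall t, half_line t ->
      ex_RInt (fun x => p x t * q_x x t) 0 1 /\
      ex_RInt (fun x => p_x x t * q x t) 0 1 /\
      RInt (fun x => p x t * q_x x t) 0 1 =
        p 1 t * q 1 t - p 0 t * q 0 t - RInt (fun x => p_x x t * q x t) 0 1.

(** The standing regularity of a solution on [0,1] x [0,oo).  [y_xt] is the
    mixed derivative in either order, and [y_xxt] is [(y_xt)_x].  Integration
    by parts is allowed with [y_xt] among the generators because the stress,
    whose [x]-derivative is the right-hand side of the equation, contains
    [eta * y_x^2 * y_xt]. *)
Record regular (y y_t y_x y_tt y_xt y_xx y_xxt : R -> R -> R) : Prop := {
  regular_y_t : is_partial_t y y_t;
  regular_y_x : is_partial_x y y_x;
  regular_y_tt : is_partial_t y_t y_tt;
  regular_y_tx : is_partial_x y_t y_xt;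
  regular_y_xt : is_partial_t y_x y_xt;
  regular_y_xx : is_partial_x y_x y_xx;
  regular_y_xxt : is_partial_x y_xt y_xxt;
  regular_diff : diff_under_integral [y; y_t; y_x];
  regular_parts : integration_by_parts [y; y_t; y_x; y_xt]
}.

Definition v_c : R := (sqrt 5 - 1) / 2.

(* Main.v *)
(** Write the right-hand side of the equation as [S_x] with
    [S = (1-v^2) y_x + b/2 y_x^3 + eta y_x^2 y_xt].  The energy
    [E = int (y_t^2/2 + (1-v^2)/2 y_x^2 + b/8 y_x^4)] is nonincreasing.
    Perturb it to [L = E + kappa int (y y_t + delta y^2 + eta/4 y_x^4)]: the
    quartic term absorbs the Kelvin-Voigt damping, and for a small [kappa] one
    has [L >= 0] and [L' <= - kappa E].  Then [L + kappa t E] is nonincreasing,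
    so [E = O(1/t)], and [y^2 <= int y_x^2] gives the pointwise decay. *)
Require Import Defs.
From Stdlib Require Import Reals List Lra Psatz.
From Coquelicot Require Import Coquelicot.
Open Scope R_scope.

(** * Calculus of derivatives relative to a domain *)

Lemma within_proper (D : R -> Prop) (s : R) :
  D s -> ProperFilter (within D (locally s)).
Proof.
  intros Ds; split.
  - intros P [e He]; exists s; apply He; [apply ball_center | exact Ds].
  - apply within_filter, locally_filter.
Qed.

Lemma within_filter_lim (D : R -> Prop) (s : R) :
  is_filter_lim (within D (locally s)) s.
Proof. intros P; apply (filter_le_within (F := locally s) D P). Qed.

Lemma is_derive_on_continuous (D : R -> Prop) (f : R -> R) (s l : R) :
  is_derive_on D f s l -> filterlim f (within D (locally s)) (locally (f s)).
Proof.
  intros Hf.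
  assert (Filter (within D (locally s))) by (apply within_filter, locally_filter).
  apply (filterdiff_continuous_aux (U := R_NormedModule) (V := R_NormedModule)
    (F := within D (locally s)) f).
  - now exists (fun h => scal h l).
  - apply within_filter_lim.
Qed.

(** In the interior the restriction to [D] is vacuous. This is the passage to ordinary derivatives,
    for which the mean value theorem and uniqueness are available. *)
Lemma is_derive_on_is_derive (D : R -> Prop) (f : R -> R) (s l : R) :
  locally s D -> is_derive_on D f s l -> is_derive f s l.
Proof.
  intros HD [Hlin Hdom]; split; [exact Hlin |].
  intros x Hx e.
  assert (x = s) as -> by (symmetry; exact (is_filter_lim_locally_unique _ _ Hx)).
  generalize (filter_and _ _ HD (Hdom s (within_filter_lim D s) e)).
  apply filter_imp; intros z [Dz Hz]; exact (Hz Dz).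
Qed.

Lemma is_derive_on_eq (D : R -> Prop) (f : R -> R) (s l l' : R) :
  is_derive_on D f s l -> l = l' -> is_derive_on D f s l'.
Proof. now intros H <-. Qed.

Lemma is_derive_on_const (D : R -> Prop) (c s : R) :
  is_derive_on D (fun _ => c) s 0.
Proof.
  assert (Filter (within D (locally s))) by (apply within_filter, locally_filter).
  eapply filterdiff_ext_lin; [apply filterdiff_const |].
  intros h; unfold scal, zero; simpl; unfold mult; simpl; ring.
Qed.

Lemma is_derive_on_plus (D : R -> Prop) (f g : R -> R) (s lf lg : R) :
  is_derive_on D f s lf -> is_derive_on D g s lg ->
  is_derive_on D (fun z => f z + g z) s (lf + lg).
Proof.
  intros Hf Hg.
  assert (Filter (within D (locally s))) by (apply within_filter, locally_filter).
  eapply filterdiff_ext_lin; [exact (filterdiff_plus_fct _ _ _ _ Hf Hg) |].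
  intros h; unfold plus, scal; simpl; unfold mult; simpl; ring.
Qed.

Lemma is_derive_on_mult (D : R -> Prop) (f g : R -> R) (s lf lg : R) :
  D s -> is_derive_on D f s lf -> is_derive_on D g s lg ->
  is_derive_on D (fun z => f z * g z) s (lf * g s + f s * lg).
Proof.
  intros Ds Hf Hg.
  assert (HF := within_proper D s Ds).
  eapply filterdiff_ext_lin.
  - refine (filterdiff_comp_2 f g Rmult _ _ (fun u w => u * g s + f s * w) Hf Hg _).
    apply (filterdiff_mult (K := R_AbsRing) (f s, g s)).
    (* The product rule is wanted along the image filter of the pair [(f, g)]; continuity of both
       factors makes that filter converge to [(f s, g s)]. *)
    + apply (is_filter_lim_filter_le (F := filter_prod (locally (f s)) (locally (g s)))).
      * apply filterlim_pair; eapply is_derive_on_continuous; eassumption.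
      * intros P [e He]; exists (ball (f s) e) (ball (g s) e).
        -- apply locally_ball.
        -- apply locally_ball.
        -- intros u w Hu Hw; apply He; now split.
    + intros; apply Rmult_comm.
  - intros h; unfold scal; simpl; unfold mult; simpl; ring.
Qed.

(** * Sum and product rules for partial derivatives *)

Section PartialDerivatives.

Variables u w u_x w_x u_t w_t : R -> R -> R.

Lemma is_partial_x_const (c : R) : is_partial_x (fun _ _ => c) (fun _ _ => 0).
Proof. intros x t _ _; apply is_derive_on_const. Qed.

Lemma is_partial_x_plus :
  is_partial_x u u_x -> is_partial_x w w_x ->
  is_partial_x (fun x t => u x t + w x t) (fun x t => u_x x t + w_x x t).
Proof.
  intros Hu Hw x t Hx Ht; apply is_derive_on_plus; [now apply Hu | now apply Hw].
Qed.

Lemma is_partial_x_mult :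
  is_partial_x u u_x -> is_partial_x w w_x ->
  is_partial_x (fun x t => u x t * w x t)
    (fun x t => u_x x t * w x t + u x t * w_x x t).
Proof.
  intros Hu Hw x t Hx Ht.
  apply (is_derive_on_mult unit_interval (fun z => u z t) (fun z => w z t));
    [exact Hx | now apply Hu | now apply Hw].
Qed.

Lemma is_partial_t_const (c : R) : is_partial_t (fun _ _ => c) (fun _ _ => 0).
Proof. intros x t _ _; apply is_derive_on_const. Qed.

Lemma is_partial_t_plus :
  is_partial_t u u_t -> is_partial_t w w_t ->
  is_partial_t (fun x t => u x t + w x t) (fun x t => u_t x t + w_t x t).
Proof.
  intros Hu Hw x t Hx Ht; apply is_derive_on_plus; [now apply Hu | now apply Hw].
Qed.

Lemma is_partial_t_mult :
  is_partial_t u u_t -> is_partial_t w w_t ->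
  is_partial_t (fun x t => u x t * w x t)
    (fun x t => u_t x t * w x t + u x t * w_t x t).
Proof.
  intros Hu Hw x t Hx Ht; apply is_derive_on_mult;
    [exact Ht | now apply Hu | now apply Hw].
Qed.

End PartialDerivatives.

Lemma is_partial_x_eq (u u_x u_x' : R -> R -> R) :
  is_partial_x u u_x -> (forall x t, u_x x t = u_x' x t) -> is_partial_x u u_x'.
Proof. intros H E x t Hx Ht; rewrite <- E; now apply H. Qed.

Lemma is_partial_t_eq (u u_t u_t' : R -> R -> R) :
  is_partial_t u u_t -> (forall x t, u_t x t = u_t' x t) -> is_partial_t u u_t'.
Proof. intros H E x t Hx Ht; rewrite <- E; now apply H. Qed.

(** * Integral identities and comparison *)

(** The integrand is [(p q)_x], and both boundary terms vanish with [p]. The form [is_RInt] carries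
    integrability along, so that such identities can be scaled and added. *)
Lemma is_RInt_total_derivative (gs : list (R -> R -> R)) (p p_x q q_x : R -> R -> R)
    (t : R) :
  integration_by_parts gs -> polynomial_in gs p -> polynomial_in gs q ->
  is_partial_x p p_x -> is_partial_x q q_x -> 0 <= t ->
  p 0 t = 0 -> p 1 t = 0 ->
  is_RInt (fun x => p x t * q_x x t + p_x x t * q x t) 0 1 0.
Proof.
  intros Hparts Hp Hq Hpx Hqx Ht H0 H1.
  destruct (Hparts p p_x q q_x Hp Hq Hpx Hqx t Ht) as [I1 [I2 HI]].
  rewrite H0, H1 in HI.
  apply (RInt_correct (V := R_CompleteNormedModule)) in I1, I2.
  generalize (is_RInt_plus _ _ _ _ _ _ I1 I2).
  unfold plus; simpl; rewrite HI; intros H.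
  eapply is_RInt_ext; [| replace 0 with
    (0 * q 1 t - 0 * q 0 t - RInt (fun x => p_x x t * q x t) 0 1
     + RInt (fun x => p_x x t * q x t) 0 1) at 2 by ring; exact H].
  now intros.
Qed.

Lemma RInt_le_of_is_RInt (f g : R -> R) (c d l : R) :
  c <= d -> ex_RInt f c d -> is_RInt g c d l ->
  (forall x, c < x < d -> f x <= g x) -> RInt f c d <= l.
Proof.
  intros Hcd If Ig Hfg; rewrite <- (is_RInt_unique _ _ _ _ Ig).
  apply RInt_le; [exact Hcd | exact If | now exists l | exact Hfg].
Qed.

(** * Pointwise bound by the Dirichlet integral *)

(** Composition with this retraction extends a function controlled only on [0,1] to the whole line,
    where the two-sided notions of continuity and derivative make sense. *)
Definition clamp (x : R) : R := Rmax 0 (Rmin 1 x).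

Lemma clamp_unit_interval (x : R) : unit_interval (clamp x).
Proof.
  split; [apply Rmax_l | apply Rmax_lub; [lra | apply Rmin_l]].
Qed.

Lemma clamp_id (x : R) : 0 <= x <= 1 -> clamp x = x.
Proof.
  intros Hx; unfold clamp; rewrite Rmin_right, Rmax_right; lra.
Qed.

Lemma clamp_continuous (x : R) : continuous clamp x.
Proof.
  apply (filterlim_locally (F := locally x)); intros e; exists e; intros z Hz.
  apply Rle_lt_trans with (2 := Hz).
  change (Rabs (clamp z - clamp x) <= Rabs (z - x)).
  unfold clamp, Rmax, Rmin.
  repeat destruct Rle_dec; unfold Rabs; repeat destruct Rcase_abs; lra.
Qed.

(** One-sided continuity at the end points is enough, because [clamp] takes all its values in
    [0,1]. *)
Lemma continuous_clamp_comp (f f' : R -> R) :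
  (forall x, unit_interval x -> is_derive_on unit_interval f x (f' x)) ->
  forall x, continuous (fun z => f (clamp z)) x.
Proof.
  intros Hf x.
  apply (filterlim_comp _ _ _ clamp f _ (within unit_interval (locally (clamp x))));
    [| apply (is_derive_on_continuous _ _ _ _ (Hf _ (clamp_unit_interval x)))].
  intros P HP.
  apply (filter_imp (F := locally x) (fun z => unit_interval (clamp z) -> P (clamp z))).
  - intros z Hz; apply Hz, clamp_unit_interval.
  - exact (clamp_continuous x _ HP).
Qed.

Lemma locally_unit_interval (x : R) : 0 < x < 1 -> locally x unit_interval.
Proof.
  intros Hx.
  apply (locally_interval _ x 0 1); simpl; try lra.
  intros z H0 H1; unfold unit_interval; split; simpl in *; lra.
Qed.

(** The derivative of [int_0^x (h'^2 / lam + lam) - 2 h] is the square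
    [(h' - lam)^2 / lam]; this optimises in [lam] to [h^2 <= int h'^2]. *)
Lemma value_le_dirichlet (h h' h'' : R -> R) (lam x : R) :
  (forall x, unit_interval x -> is_derive_on unit_interval h x (h' x)) ->
  (forall x, unit_interval x -> is_derive_on unit_interval h' x (h'' x)) ->
  h 0 = 0 -> 0 < lam -> 0 <= x <= 1 ->
  2 * h x <= RInt (fun z => h' z * h' z) 0 1 / lam + lam.
Proof.
  intros Hh Hh' H0 Hlam Hx.
  (* [c] is continuous everywhere because [h'] is itself differentiable; hence [k] has a primitive
     on the whole line. *)
  set (c := fun z => h' (clamp z)).
  set (k := fun z => c z * c z / lam + lam).
  assert (Hc : forall z, continuous c z) by (apply (continuous_clamp_comp _ _ Hh')).
  assert (Hc2 : forall z, continuous (fun z => c z * c z) z).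
  { intros z; apply (continuous_mult c c z); apply Hc. }
  assert (Hk : forall z, continuous k z).
  { intros z; apply (continuous_plus (fun z => c z * c z / lam) (fun _ => lam));
      [| apply continuous_const].
    apply (continuous_mult (fun z => c z * c z) (fun _ => / lam));
      [apply Hc2 | apply continuous_const]. }
  assert (Ik : forall a d, ex_RInt k a d).
  { intros a d; apply (ex_RInt_continuous k); intros; apply Hk. }
  assert (Dk : forall z, is_derive (fun s => RInt k 0 s) z (k z)).
  { intros z; apply is_derive_RInt with 0; [| apply Hk].
    apply filter_forall; intros s; apply (RInt_correct (V := R_CompleteNormedModule)), Ik. }
  assert (Hkx : 2 * h x <= RInt k 0 x).
  { set (H := fun z => RInt k 0 z - 2 * h (clamp z)).
    destruct (MVT_gen H 0 x (fun z => k z - 2 * c z)) as [z [_ Hz]].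
    - rewrite Rmin_left, Rmax_right by lra; intros z Hz.
      apply (is_derive_minus (fun s => RInt k 0 s) (fun s => 2 * h (clamp s))).
      + apply Dk.
      + apply (is_derive_scal (fun s => h (clamp s))).
        unfold c; rewrite clamp_id by lra.
        apply (is_derive_ext_loc h).
        * generalize (locally_unit_interval z ltac:(lra)).
          apply filter_imp; intros s Hs; now rewrite clamp_id.
        * apply (is_derive_on_is_derive unit_interval).
          -- apply locally_unit_interval; lra.
          -- apply Hh; split; lra.
    - intros z _; apply continuity_pt_filterlim.
      apply (continuous_minus (fun s => RInt k 0 s) (fun s => 2 * h (clamp s)) z).
      + apply (ex_derive_continuous (fun s => RInt k 0 s)).
        eexists; apply Dk.
      + apply (continuous_mult (fun _ => 2) (fun s => h (clamp s)));
          [apply continuous_const | apply (continuous_clamp_comp _ _ Hh)].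
    (* [H] vanishes at [0] because [h 0 = 0], so the sign of its derivative decides the sign of
       [H x]. *)
    - unfold H in Hz; rewrite RInt_point, !clamp_id, H0 in Hz by lra.
      unfold zero in Hz; simpl in Hz.
      assert (0 <= k z - 2 * c z).
      { replace (k z - 2 * c z) with ((c z - lam) ^ 2 / lam)
          by (unfold k; field; lra).
        apply Rmult_le_pos; [apply pow2_ge_0 | now apply Rlt_le, Rinv_0_lt_compat]. }
      nra. }
  apply Rle_trans with (1 := Hkx).
  (* Since [k] is nonnegative, enlarging the interval to [0,1] does not decrease the integral. *)
  apply Rle_trans with (RInt k 0 1).
  - rewrite <- (RInt_Chasles k 0 x 1 (Ik _ _) (Ik _ _)).
    unfold plus; simpl.
    assert (0 <= RInt k x 1); [| lra].
    apply RInt_ge_0; [lra | apply Ik |]; intros z _; unfold k.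
    assert (0 <= c z * c z / lam); [| lra].
    apply Rmult_le_pos; [nra | now apply Rlt_le, Rinv_0_lt_compat].
  - apply Req_le.
    assert (J : is_RInt (fun z => c z * c z) 0 1 (RInt (fun z => c z * c z) 0 1)).
    { apply (RInt_correct (V := R_CompleteNormedModule)), (ex_RInt_continuous (fun z => c z * c z)); intros; apply Hc2. }
    rewrite (RInt_ext (fun z => h' z * h' z) (fun z => c z * c z)).
    2:{ intros z; rewrite Rmin_left, Rmax_right by lra; intros Hz.
        unfold c; now rewrite clamp_id by lra. }
    apply is_RInt_unique.
    generalize (is_RInt_plus _ _ _ _ _ _ (is_RInt_scal _ _ _ (/ lam) _ J)
                 (is_RInt_const 0 1 lam)).
    unfold plus, scal; simpl; unfold mult; simpl; intros Jk.
    replace (RInt (fun z => c z * c z) 0 1 / lam + lam)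
      with (/ lam * RInt (fun z => c z * c z) 0 1 + (1 - 0) * lam)
      by (field; lra).
    eapply is_RInt_ext; [| exact Jk].
    intros z _; unfold k; simpl; field; lra.
Qed.

(** The one-sided bound is applied to [h] and to [-h], which have the same Dirichlet integral. *)
Lemma abs_le_dirichlet (h h' h'' : R -> R) (lam x : R) :
  (forall x, unit_interval x -> is_derive_on unit_interval h x (h' x)) ->
  (forall x, unit_interval x -> is_derive_on unit_interval h' x (h'' x)) ->
  h 0 = 0 -> 0 < lam -> 0 <= x <= 1 ->
  2 * Rabs (h x) <= RInt (fun z => h' z * h' z) 0 1 / lam + lam.
Proof.
  intros Hh Hh' H0 Hlam Hx.
  assert (P := value_le_dirichlet h h' h'' lam x Hh Hh' H0 Hlam Hx).
  assert (Hneg : forall (f f' : R -> R),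
    (forall x, unit_interval x -> is_derive_on unit_interval f x (f' x)) ->
    forall x, unit_interval x ->
      is_derive_on unit_interval (fun z => -1 * f z) x (-1 * f' x)).
  { intros f f' Hf z Hz; eapply is_derive_on_eq.
    - apply is_derive_on_mult; [exact Hz | apply is_derive_on_const | now apply Hf].
    - simpl; ring. }
  assert (N := value_le_dirichlet _ _ _ lam x (Hneg _ _ Hh) (Hneg _ _ Hh')
                 ltac:(lra) Hlam Hx).
  rewrite (RInt_ext _ (fun z => h' z * h' z)) in N by (intros; simpl; ring).
  unfold Rabs; destruct Rcase_abs; lra.
Qed.

(** * Monotonicity in time, and tactics for polynomial expressions *)

Lemma nonincreasing_of_derive (F F' : R -> R) (s t : R) :
  s <= t -> (forall r, s <= r -> is_derive F r (F' r)) ->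
  (forall r, s <= r -> F' r <= 0) -> F t <= F s.
Proof.
  intros Hst HF HF'.
  destruct (MVT_gen F s t F') as [r [Hr E]].
  - rewrite Rmin_left by lra; intros r Hr; apply HF; lra.
  - rewrite Rmin_left by lra; intros r Hr; apply continuity_pt_filterlim.
    apply (ex_derive_continuous F); eexists; apply HF; lra.
  - rewrite Rmin_left in Hr by lra.
    assert (F' r <= 0) by (apply HF'; lra); nra.
Qed.

Lemma locally_half_line (t : R) : 0 < t -> locally t half_line.
Proof.
  intros Ht; apply (locally_interval _ t 0 p_infty); simpl; try easy.
  intros z Hz _; unfold half_line; lra.
Qed.

Ltac solve_polynomial :=
  repeat first [ apply polynomial_add | apply polynomial_mul
               | apply polynomial_const
               | apply polynomial_gen; simpl; tauto ].

(** The derivative in the goal is left as an existential variable, which the sum and product rules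
    fill in. Hypotheses are tried first, so a density with a known derivative is not taken apart. *)
Ltac solve_partial_t :=
  match goal with
  | H : is_partial_t ?u _ |- is_partial_t ?u _ => exact H
  | |- is_partial_t (fun x t => _ + _) _ =>
      apply is_partial_t_plus; solve_partial_t
  | |- is_partial_t (fun x t => _ * _) _ =>
      apply is_partial_t_mult; solve_partial_t
  | |- is_partial_t (fun _ _ => _) _ => apply is_partial_t_const
  end.

Ltac solve_partial_x :=
  match goal with
  | H : is_partial_x ?u _ |- is_partial_x ?u _ => exact H
  | |- is_partial_x (fun x t => _ + _) _ =>
      apply is_partial_x_plus; solve_partial_x
  | |- is_partial_x (fun x t => _ * _) _ =>
      apply is_partial_x_mult; solve_partial_x
  | |- is_partial_x (fun _ _ => _) _ => apply is_partial_x_const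
  end.

(** * The string: densities, stress and their derivatives *)

Section String.

Variables (b delta eta v : R) (y y_t y_x y_tt y_xt y_xx y_xxt : R -> R -> R).

Hypotheses (hb : 0 < b) (hdelta : 0 < delta) (heta : 0 < eta)
  (hv : v ^ 2 < 1)
  (hreg : regular y y_t y_x y_tt y_xt y_xx y_xxt)
  (hpde : forall x t, 0 < x < 1 -> 0 <= t ->
       y_tt x t + 2 * delta * y_t x t + 2 * v * y_xt x t
       = (1 - v ^ 2 + 3 / 2 * b * (y_x x t) ^ 2) * y_xx x t
         + 2 * eta * y_x x t * y_xx x t * y_xt x t
         + eta * (y_x x t) ^ 2 * y_xxt x t)
  (hbc : forall t, 0 <= t -> y 0 t = 0 /\ y 1 t = 0).

Let a := 1 - v ^ 2.
(* Solves [a (delta - kappa) = 2 kappa], which together with [v^2 <= 1] makes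
   [cross_term_bound] an instance of AM-GM. *)
Let kappa := delta * a / (a + 2).

(** Powers are spelled as products here, in [perturbation_density] and in [stress]: this is the
    shape on which the tactics recurse. *)
Definition energy_density (x t : R) : R :=
  1 / 2 * (y_t x t * y_t x t) + a / 2 * (y_x x t * y_x x t)
  + b / 8 * (y_x x t * y_x x t * (y_x x t * y_x x t)).

Definition energy_density_t (x t : R) : R :=
  y_t x t * y_tt x t + a * (y_x x t * y_xt x t)
  + b / 2 * (y_x x t ^ 3 * y_xt x t).

(** The time derivative of [delta * y^2] cancels the viscous part of [y * y_tt]. That of the quartic
    term cancels [- eta * y_x^3 * y_xt], which appears when [y * stress_x] is integrated by
    parts. *)
Definition perturbation_density (x t : R) : R :=
  y x t * y_t x t + delta * (y x t * y x t)
  + eta / 4 * (y_x x t * y_x x t * (y_x x t * y_x x t)).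

Definition perturbation_density_t (x t : R) : R :=
  y_t x t ^ 2 + y x t * y_tt x t + 2 * delta * (y x t * y_t x t)
  + eta * (y_x x t ^ 3 * y_xt x t).

Definition lyapunov_density (x t : R) : R :=
  energy_density x t + kappa * perturbation_density x t.

Definition lyapunov_density_t (x t : R) : R :=
  energy_density_t x t + kappa * perturbation_density_t x t.

Definition stress (x t : R) : R :=
  a * y_x x t + b / 2 * (y_x x t * (y_x x t * y_x x t))
  + eta * (y_x x t * y_x x t * y_xt x t).

(** Kept literally as the right-hand side of [hpde], with [1 - v ^ 2] in place of [a], so that
    [fold] recognises it there. *)
Definition stress_x (x t : R) : R :=
  (1 - v ^ 2 + 3 / 2 * b * (y_x x t) ^ 2) * y_xx x t
  + 2 * eta * y_x x t * y_xx x t * y_xt x t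
  + eta * (y_x x t) ^ 2 * y_xxt x t.

Definition energy (t : R) : R := RInt (fun x => energy_density x t) 0 1.

Definition lyapunov (t : R) : R := RInt (fun x => lyapunov_density x t) 0 1.

Lemma a_pos : 0 < a.
Proof. unfold a; lra. Qed.

Lemma kappa_pos : 0 < kappa.
Proof.
  assert (Ha := a_pos); unfold kappa.
  apply Rdiv_lt_0_compat; [apply Rmult_lt_0_compat |]; lra.
Qed.

Lemma kappa_spec : kappa * (a + 2) = delta * a.
Proof. assert (Ha := a_pos); unfold kappa; field; lra. Qed.

Lemma kappa_le : kappa <= delta.
Proof. assert (Ha := a_pos); assert (Hk := kappa_spec); nra. Qed.

Lemma energy_density_partial_t : is_partial_t energy_density energy_density_t.
Proof.
  destruct hreg as [R1 R2 R3 R4 R5 R6 R7 _ _].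
  unfold energy_density; eapply is_partial_t_eq; [solve_partial_t |].
  intros x t; unfold energy_density_t; simpl; field.
Qed.

Lemma perturbation_density_partial_t :
  is_partial_t perturbation_density perturbation_density_t.
Proof.
  destruct hreg as [R1 R2 R3 R4 R5 R6 R7 _ _].
  unfold perturbation_density; eapply is_partial_t_eq; [solve_partial_t |].
  intros x t; unfold perturbation_density_t; simpl; field.
Qed.

Lemma lyapunov_density_partial_t : is_partial_t lyapunov_density lyapunov_density_t.
Proof.
  assert (H1 := energy_density_partial_t).
  assert (H2 := perturbation_density_partial_t).
  unfold lyapunov_density; eapply is_partial_t_eq; [solve_partial_t |].
  intros x t; unfold lyapunov_density_t; simpl; ring.
Qed.

Lemma stress_partial_x : is_partial_x stress stress_x.
Proof.
  destruct hreg as [R1 R2 R3 R4 R5 R6 R7 _ _].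
  unfold stress; eapply is_partial_x_eq; [solve_partial_x |].
  intros x t; unfold stress_x, a; simpl; field.
Qed.

(** * Boundary terms and differentiation under the integral *)

(** The end values of [y] are constant in time. For [t > 0] the time derivative is two-sided, so its
    uniqueness applies; the dissipation estimates inherit this strict positivity. *)
Lemma y_t_boundary (t : R) : 0 < t -> y_t 0 t = 0 /\ y_t 1 t = 0.
Proof.
  intros Ht.
  assert (Z : forall x, unit_interval x -> (forall s, 0 <= s -> y x s = 0) ->
    y_t x t = 0).
  { intros x Hx Hy.
    assert (D := is_derive_on_is_derive _ _ _ _ (locally_half_line t Ht)
      (regular_y_t _ _ _ _ _ _ _ hreg x t Hx (Rlt_le _ _ Ht))).
    assert (D0 : is_derive (fun s => y x s) t 0).
    { apply (is_derive_ext_loc (fun _ => 0)); [| apply (is_derive_const (V := R_NormedModule))].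
      generalize (locally_half_line t Ht); apply filter_imp.
      intros s Hs; symmetry; now apply Hy. }
    rewrite <- (is_derive_unique _ _ _ D); exact (is_derive_unique _ _ _ D0). }
  split; apply Z; try (split; lra); intros; now apply hbc.
Qed.

(** The four brackets are the [x]-derivatives of [y_t * stress], [y * stress], [y_t^2] and
    [y * y_t], products that vanish at both ends. With free coefficients, a suitable combination can
    be put on the larger side of an integral inequality, which is then proved pointwise. *)
Lemma is_RInt_flux (c1 c2 c3 c4 t : R) : 0 < t ->
  is_RInt (fun x =>
    c1 * (y_t x t * stress_x x t + y_xt x t * stress x t)
    + c2 * (y x t * stress_x x t + y_x x t * stress x t)
    + c3 * (2 * y_t x t * y_xt x t)
    + c4 * (y x t * y_xt x t + y_x x t * y_t x t)) 0 1 0.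
Proof.
  intros Ht.
  assert (Hs := stress_partial_x).
  assert (Hps : polynomial_in (y :: y_t :: y_x :: y_xt :: nil) stress)
    by (unfold stress; solve_polynomial).
  assert (Hpy : polynomial_in (y :: y_t :: y_x :: y_xt :: nil) y) by solve_polynomial.
  assert (Hpt : polynomial_in (y :: y_t :: y_x :: y_xt :: nil) y_t) by solve_polynomial.
  destruct (y_t_boundary t Ht) as [T0 T1].
  destruct (hbc t (Rlt_le _ _ Ht)) as [Y0 Y1].
  assert (Ht' := Rlt_le _ _ Ht).
  destruct hreg as [R1 R2 R3 R4 R5 R6 R7 _ R9].
  assert (J1 := is_RInt_total_derivative _ y_t y_xt stress stress_x t
    R9 Hpt Hps R4 Hs Ht' T0 T1).
  assert (J2 := is_RInt_total_derivative _ y y_x stress stress_x t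
    R9 Hpy Hps R2 Hs Ht' Y0 Y1).
  assert (J3 := is_RInt_total_derivative _ y_t y_xt y_t y_xt t
    R9 Hpt Hpt R4 R4 Ht' T0 T1).
  assert (J4 := is_RInt_total_derivative _ y y_x y_t y_xt t
    R9 Hpy Hpt R2 R4 Ht' Y0 Y1).
  assert (J := is_RInt_plus _ _ _ _ _ _
    (is_RInt_plus _ _ _ _ _ _
      (is_RInt_plus _ _ _ _ _ _ (is_RInt_scal _ _ _ c1 _ J1)
         (is_RInt_scal _ _ _ c2 _ J2))
      (is_RInt_scal _ _ _ c3 _ J3))
    (is_RInt_scal _ _ _ c4 _ J4)).
  replace 0 with (plus (plus (plus (scal c1 0) (scal c2 0)) (scal c3 0)) (scal c4 0)) at 2.
  - eapply is_RInt_ext; [| exact J].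
    intros x _; unfold plus, scal; simpl; unfold mult; simpl; ring.
  - unfold plus, scal; simpl; unfold mult; simpl; ring.
Qed.

Lemma ex_RInt_polynomial (p p_t : R -> R -> R) (t : R) :
  polynomial_in (y :: y_t :: y_x :: nil) p -> is_partial_t p p_t -> 0 <= t ->
  ex_RInt (fun x => p x t) 0 1 /\ ex_RInt (fun x => p_t x t) 0 1.
Proof.
  intros Hp Hpt Ht.
  destruct (regular_diff _ _ _ _ _ _ _ hreg p p_t Hp Hpt t Ht) as [I1 [I2 _]].
  now split.
Qed.

Lemma is_derive_RInt_polynomial (p p_t : R -> R -> R) (t : R) :
  polynomial_in (y :: y_t :: y_x :: nil) p -> is_partial_t p p_t -> 0 < t ->
  is_derive (fun s => RInt (fun x => p x s) 0 1) t (RInt (fun x => p_t x t) 0 1).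
Proof.
  intros Hp Hpt Ht.
  destruct (regular_diff _ _ _ _ _ _ _ hreg p p_t Hp Hpt t (Rlt_le _ _ Ht))
    as [_ [_ D]].
  exact (is_derive_on_is_derive _ _ _ _ (locally_half_line t Ht) D).
Qed.

Lemma energy_density_polynomial :
  polynomial_in (y :: y_t :: y_x :: nil) energy_density.
Proof. unfold energy_density; solve_polynomial. Qed.

Lemma lyapunov_density_polynomial :
  polynomial_in (y :: y_t :: y_x :: nil) lyapunov_density.
Proof.
  unfold lyapunov_density, perturbation_density, energy_density; solve_polynomial.
Qed.

(** * Dissipation estimates *)

(** By the equation, the density equals [(y_t * stress - v * y_t^2)_x] minus the two damping terms
    [2 * delta * y_t^2] and [eta * (y_x * y_xt)^2]. *)
Lemma energy_dissipation (t : R) : 0 < t ->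
  RInt (fun x => energy_density_t x t) 0 1 <= 0.
Proof.
  intros Ht.
  assert (J := is_RInt_flux 1 0 (- v) 0 t Ht).
  apply (RInt_le_of_is_RInt _ _ _ _ _ Rle_0_1) with (2 := J).
  - apply (ex_RInt_polynomial _ _ t energy_density_polynomial
      energy_density_partial_t); lra.
  - intros x Hx.
    assert (E := hpde x t Hx (Rlt_le _ _ Ht)).
    fold (stress_x x t) in E.
    unfold energy_density_t.
    replace (y_tt x t) with (stress_x x t - 2 * delta * y_t x t - 2 * v * y_xt x t)
      by lra.
    assert (0 <= 2 * delta * y_t x t ^ 2 + eta * (y_x x t * y_xt x t) ^ 2).
    { apply Rplus_le_le_0_compat; apply Rmult_le_pos; try apply pow2_ge_0; lra. }
    unfold stress; lra.
Qed.

(** With [p = y_t] and [q = y_x], the left side is what the transport term [2 * v * y_xt], tested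
    with [kappa * y], leaves after integration by parts. *)
Lemma cross_term_bound (p q : R) :
  kappa * (2 * v * q * p)
  <= kappa * (a / 2) * q ^ 2 + (delta - kappa) * p ^ 2.
Proof.
  assert (Ha := a_pos); assert (Hk := kappa_pos); assert (Hs := kappa_spec).
  (* After this scaling the two sides differ by [kappa * (a * q - 2 * v * p)^2 + 4 * kappa * (1 -
     v^2) * p^2]. *)
  apply Rmult_le_reg_l with (2 * a); [lra |].
  assert (0 <= kappa * (a * q - 2 * v * p) ^ 2)
    by (apply Rmult_le_pos; [lra | apply pow2_ge_0]).
  assert (E : a * (delta - kappa) = 2 * kappa) by lra.
  assert (0 <= kappa * (1 - v ^ 2) * p ^ 2)
    by (apply Rmult_le_pos; [apply Rmult_le_pos; lra | apply pow2_ge_0]).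
  replace (2 * a * (kappa * (a / 2) * q ^ 2 + (delta - kappa) * p ^ 2))
    with (kappa * a ^ 2 * q ^ 2 + 2 * (a * (delta - kappa)) * p ^ 2) by field.
  rewrite E; lra.
Qed.

Lemma lyapunov_dissipation (t : R) : 0 < t ->
  RInt (fun x => lyapunov_density_t x t) 0 1 <= - kappa * energy t.
Proof.
  intros Ht.
  assert (Ha := a_pos); assert (Hk := kappa_pos); assert (Hkd := kappa_le).
  (* Coefficients [1] and [- v] are those of the energy balance; [kappa] and [- 2 * v * kappa]
     integrate [kappa * y * stress_x] and [- 2 * v * kappa * y * y_xt] by parts. *)
  assert (J := is_RInt_flux 1 kappa (- v) (- 2 * v * kappa) t Ht).
  assert (IE : is_RInt (fun x => energy_density x t) 0 1 (energy t)).
  { apply (RInt_correct (V := R_CompleteNormedModule)).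
    apply (ex_RInt_polynomial _ _ t energy_density_polynomial
      energy_density_partial_t); lra. }
  assert (K := is_RInt_plus _ _ _ _ _ _ J (is_RInt_scal _ _ _ (- kappa) _ IE)).
  replace (- kappa * energy t) with (plus 0 (scal (- kappa) (energy t)))
    by (unfold plus, scal; simpl; unfold mult; simpl; ring).
  apply (RInt_le_of_is_RInt _ _ _ _ _ Rle_0_1) with (2 := K).
  - apply (ex_RInt_polynomial _ _ t lyapunov_density_polynomial
      lyapunov_density_partial_t); lra.
  - intros x Hx.
    assert (E := hpde x t Hx (Rlt_le _ _ Ht)).
    fold (stress_x x t) in E.
    unfold plus, scal; simpl; unfold mult; simpl.
    unfold lyapunov_density_t, energy_density_t, perturbation_density_t,
      energy_density.
    replace (y_tt x t) with (stress_x x t - 2 * delta * y_t x t - 2 * v * y_xt x t)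
      by lra.
    (* Once [- kappa * energy_density] is taken out, [2 * delta - 3/2 * kappa] of the [y_t^2]
       damping remains: [H2] uses [delta - kappa] of it and [H3] is the rest. [H4] is the quartic
       surplus [b/2 - b/8], times [kappa]. *)
    assert (H1 : 0 <= eta * (y_x x t * y_xt x t) ^ 2)
      by (apply Rmult_le_pos; [lra | apply pow2_ge_0]).
    assert (H2 := cross_term_bound (y_t x t) (y_x x t)).
    assert (H3 : 0 <= (delta - kappa / 2) * y_t x t ^ 2)
      by (apply Rmult_le_pos; [lra | apply pow2_ge_0]).
    assert (H4 : 0 <= kappa * b * 3 / 8 * (y_x x t ^ 2) ^ 2).
    { apply Rmult_le_pos; [| apply pow2_ge_0].
      assert (0 < kappa * b) by (now apply Rmult_lt_0_compat); lra. }
    unfold stress; lra.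
Qed.

(** The density is nonnegative at each point: its only indefinite term is [y * y_t], which the
    kinetic energy and [delta * y^2] control because [kappa <= delta]. *)
Lemma lyapunov_nonneg (t : R) : 0 <= t -> 0 <= lyapunov t.
Proof.
  intros Ht.
  assert (Ha := a_pos); assert (Hk := kappa_pos); assert (Hkd := kappa_le).
  apply RInt_ge_0; [lra | |].
  - now apply (ex_RInt_polynomial _ _ t lyapunov_density_polynomial
      lyapunov_density_partial_t).
  - intros x _; unfold lyapunov_density, energy_density, perturbation_density.
    set (p := y_t x t); set (q := y_x x t); set (z := y x t).
    assert (H1 : 0 <= a / 2 * (q * q)) by (apply Rmult_le_pos; nra).
    assert (H2 : 0 <= b / 8 * (q * q * (q * q))) by (apply Rmult_le_pos; nra).
    assert (H3 : 0 <= kappa * (eta / 4 * (q * q * (q * q)))).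
    { apply Rmult_le_pos; [lra | apply Rmult_le_pos; nra]. }
    assert (H4 : 0 <= 1 / 2 * (p * p) + kappa * (z * p + delta * (z * z))).
    (* Times [delta], the expression is [kappa * (delta * z + p / 2)^2 + (delta - kappa / 2) * p^2 /
       2]. *)
    { apply Rmult_le_reg_l with delta; [lra |].
      assert (0 <= kappa * (delta * z + p / 2) ^ 2)
        by (apply Rmult_le_pos; [lra | apply pow2_ge_0]).
      assert (0 <= (delta - kappa / 2) * p ^ 2)
        by (apply Rmult_le_pos; [lra | apply pow2_ge_0]).
      lra. }
    lra.
Qed.

(** * Decay of the energy and of the solution *)

(** The derivative of [lyapunov + kappa * s * energy] is at most
    [- kappa * energy + kappa * energy]. The comparison starts at time 1, inside the range where
    time derivatives are two-sided. *)
Lemma energy_decay (t : R) : 1 <= t ->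
  kappa * t * energy t <= lyapunov 1 + kappa * energy 1.
Proof.
  intros Ht.
  assert (Hk := kappa_pos).
  assert (H : lyapunov t + kappa * t * energy t <= lyapunov 1 + kappa * 1 * energy 1).
  { apply (nonincreasing_of_derive (fun s => lyapunov s + kappa * s * energy s)
      (fun s => RInt (fun x => lyapunov_density_t x s) 0 1
         + (kappa * energy s + kappa * s * RInt (fun x => energy_density_t x s) 0 1)));
      [exact Ht | |].
    - intros r Hr.
      assert (DL : is_derive lyapunov r (RInt (fun x => lyapunov_density_t x r) 0 1)).
      { apply is_derive_RInt_polynomial;
          [apply lyapunov_density_polynomial | apply lyapunov_density_partial_t | lra]. }
      assert (DE : is_derive energy r (RInt (fun x => energy_density_t x r) 0 1)).
      { apply is_derive_RInt_polynomial;
          [apply energy_density_polynomial | apply energy_density_partial_t | lra]. }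
      apply (is_derive_plus lyapunov (fun s => kappa * s * energy s)); [exact DL |].
      apply (is_derive_mult (fun s => kappa * s) energy r kappa _);
        [auto_derive; [easy | ring] | exact DE | intros; apply Rmult_comm].
    - intros r Hr.
      assert (H1 := lyapunov_dissipation r ltac:(lra)).
      assert (H2 := energy_dissipation r ltac:(lra)).
      assert (H3 : 0 <= kappa * r) by (apply Rmult_le_pos; lra).
      nra. }
  assert (H0 := lyapunov_nonneg t ltac:(lra)); lra.
Qed.

Lemma dirichlet_le_energy (t : R) : 0 <= t ->
  a / 2 * RInt (fun x => y_x x t * y_x x t) 0 1 <= energy t.
Proof.
  intros Ht.
  destruct hreg as [R1 R2 R3 R4 R5 R6 R7 _ _].
  (* Integrability is read off the clause on differentiation under the integral, which is why a time
     derivative is supplied. *)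
  assert (I : ex_RInt (fun x => y_x x t * y_x x t) 0 1).
  { apply (ex_RInt_polynomial (fun x t => y_x x t * y_x x t)
      (fun x t => y_xt x t * y_x x t + y_x x t * y_xt x t) t);
      [solve_polynomial | solve_partial_t | exact Ht]. }
  apply (RInt_correct (V := R_CompleteNormedModule)) in I.
  apply (is_RInt_scal _ _ _ (a / 2)) in I.
  change (scal (a / 2) (RInt (fun x => y_x x t * y_x x t) 0 1) <= energy t).
  assert (IE : is_RInt (fun x => energy_density x t) 0 1 (energy t)).
  { apply (RInt_correct (V := R_CompleteNormedModule)).
    now apply (ex_RInt_polynomial _ _ t energy_density_polynomial
      energy_density_partial_t). }
  apply (is_RInt_le _ _ _ _ _ _ Rle_0_1 I IE).
  intros x _; unfold energy_density, scal; simpl; unfold mult; simpl.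
  set (p := y_t x t); set (q := y_x x t).
  assert (0 <= b / 8 * (q * q * (q * q))) by (apply Rmult_le_pos; nra).
  nra.
Qed.

Lemma solution_decay (x : R) : 0 <= x <= 1 -> is_lim (fun t => y x t) p_infty 0.
Proof.
  intros Hx.
  assert (Ha := a_pos); assert (Hk := kappa_pos).
  (* Combining [dirichlet_le_energy] with [energy_decay] bounds [t] times the Dirichlet integral by
     this constant. *)
  set (K := 2 * (lyapunov 1 + kappa * energy 1) / (a * kappa)).
  apply is_lim_spec; intros e.
  assert (He := cond_pos e).
  exists (Rmax 1 (K / e ^ 2)); intros t Ht.
  assert (Ht1 : 1 < t) by (eapply Rle_lt_trans; [apply Rmax_l | exact Ht]).
  assert (HtK : K / e ^ 2 < t) by (eapply Rle_lt_trans; [apply Rmax_r | exact Ht]).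
  rewrite Rminus_0_r.
  (* With [lam = e] the bound reads [2 * Rabs (y x t) <= I / e + e], so it suffices that the
     Dirichlet integral [I] is below [e^2], which holds once [t > K / e^2]. *)
  assert (B := abs_le_dirichlet (fun z => y z t) (fun z => y_x z t) (fun z => y_xx z t)
    e x).
  simpl in B.
  assert (0 <= t) by lra.
  specialize (B (fun z Hz => regular_y_x _ _ _ _ _ _ _ hreg z t Hz H)
    (fun z Hz => regular_y_xx _ _ _ _ _ _ _ hreg z t Hz H)
    (proj1 (hbc t H)) He Hx).
  assert (D := dirichlet_le_energy t H).
  assert (E := energy_decay t ltac:(lra)).
  set (I := RInt (fun z => y_x z t * y_x z t) 0 1 : R) in *.
  assert (HIt : t * I <= K).
  { apply Rmult_le_reg_l with (a * kappa / 2); [nra |].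
    replace (a * kappa / 2 * K) with (lyapunov 1 + kappa * energy 1)
      by (unfold K; field; lra).
    apply Rle_trans with (2 := E).
    replace (a * kappa / 2 * (t * I)) with (kappa * t * (a / 2 * I)) by field.
    apply Rmult_le_compat_l; [apply Rmult_le_pos; lra | exact D]. }
  assert (HKt : K < t * e ^ 2).
  { apply Rmult_lt_reg_r with (/ e ^ 2); [apply Rinv_0_lt_compat; nra |].
    replace (t * e ^ 2 * / e ^ 2) with t by (field; lra).
    exact HtK. }
  assert (HI : I < e ^ 2) by (apply Rmult_lt_reg_l with t; lra).
  assert (I / e < e).
  { apply Rmult_lt_reg_r with e; [exact He |].
    replace (I / e * e) with I by (field; apply Rgt_not_eq, He); lra. }
  lra.
Qed.

End String.

Theorem corollary2p4 (b delta eta v : R) (f g : R -> R)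
    (y y_t y_x y_tt y_xt y_xx y_xxt : R -> R -> R)
    (hb : 0 < b) (hdelta : 0 < delta) (heta : 0 < eta)
    (hv0 : 0 <= v) (hv : v < v_c)
    (hf : C1_unit_interval f)
    (hfg : ~ (forall x, 0 <= x <= 1 -> f x = 0) \/
           ~ (forall x, 0 <= x <= 1 -> g x = 0))
    (hreg : regular y y_t y_x y_tt y_xt y_xx y_xxt)
    (hpde : forall x t, 0 < x < 1 -> 0 <= t ->
       y_tt x t + 2 * delta * y_t x t + 2 * v * y_xt x t
       = (1 - v ^ 2 + 3 / 2 * b * (y_x x t) ^ 2) * y_xx x t
         + 2 * eta * y_x x t * y_xx x t * y_xt x t
         + eta * (y_x x t) ^ 2 * y_xxt x t)
    (hbc : forall t, 0 <= t -> y 0 t = 0 /\ y 1 t = 0)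
    (hic : forall x, 0 < x < 1 -> y x 0 = f x /\ y_t x 0 = g x) :
  forall x, 0 <= x <= 1 -> is_lim (fun t => y x t) p_infty 0.
Proof.
  (* From [sqrt 5 <= 3] one gets [v_c <= 1]; together with [0 <= v] this yields [v ^ 2 < 1], the
     form in which [solution_decay] takes the speed bound. *)
  assert (Hv1 : v < 1).
  { apply Rlt_le_trans with (1 := hv); unfold v_c.
    assert (sqrt 5 <= 3); [| lra].
    rewrite <- (sqrt_pow2 3) by lra; apply sqrt_le_1; lra. }
  apply (solution_decay b delta eta v y y_t y_x y_tt y_xt y_xx y_xxt); try assumption.
  nra.
Qed.
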